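(* The negative eigenvalues of $\mathcal A_3$ lie in the interval $$I_-=\Big[\tfrac12\big(\tau_{min}-\sqrt{\tau_{min}^2+4\theta_{max}^2}\big),\ \tfrac12\big(\tau_{max}-\sqrt{\tau_{max}^2+4\theta_{min}^2}\big)\Big]$$ and the positive eigenvalues of $\mathcal A_3$ lie in the interval $$I_+=\Big[\tau_{min},\ \tfrac12\big(\tau_{max}+\sqrt{\tau_{max}^2+4\theta_{max}^2}\big)\Big].$$
   Context: Let $N,n\ge 1$ be integers, $m=(N+1)n$, $p_0,\dots,p_N\ge 0$ integers with $p=\sum_{i=0}^N p_i\ge 1$. Let $B,Q_1,\dots,Q_N\in\mathbb R^{n\times n}$ and $R_i\in\mathbb R^{p_i\times p_i}$ ($0\le i\le N$) be symmetric positive definite, and let $M_0,\dots,M_{N-1}\in\mathbb R^{n\times n}$, $H_i\in\mathbb R^{p_i\times n}$ ($0\le i\le N$) be arbitrary. Define the block diagonal matrices $\mathbf D=\mathrm{diag}(B,Q_1,\dots,Q_N)\in\mathbb R^{m\times m}$, $\mathbf R=\mathrm{diag}(R_0,\dots,R_N)\in\mathbb R^{p\times p}$, $\mathbf H=\mathrm{diag}(H_0,\dots,H_N)\in\mathbb R^{p\times m}$, and let $\mathbf L\in\mathbb R^{m\times m}$ be the block lower bidiagonal matrix with $n\times n$ identity blocks on the diagonal and blocks $-M_0,\dots,-M_{N-1}$ on the first block subdiagonal (all other blocks zero). Define $$\mathcal A_3=\begin{pmatrix}\mathbf D&\mathbf 0&\mathbf L\\ \mathbf 0&\mathbf R&\mathbf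 H\\ \mathbf L^T&\mathbf H^T&\mathbf 0\end{pmatrix}\in\mathbb R^{(2m+p)\times(2m+p)}.$$ Notation: $\psi_{min},\psi_{max}$ are the smallest and largest eigenvalues of $\mathbf D$; $\rho_{min},\rho_{max}$ those of $\mathbf R$; $\tau_{min}=\min\{\psi_{min},\rho_{min}\}$, $\tau_{max}=\max\{\psi_{max},\rho_{max}\}$; $\theta_{min}$ and $\theta_{max}$ are the smallest nonzero and the largest singular values of $(\mathbf L^T\ \ \mathbf H^T)\in\mathbb R^{m\times(m+p)}$. *)

(* Defs.v *)
From mathcomp Require Import all_boot all_order all_algebra.
From mathcomp Require Import reals.

Set Implicit Arguments.
Unset Strict Implicit.
Unset Printing Implicit Defensive.

Import Order.TTheory GRing.Theory Num.Theory.
Local Open Scope ring_scope.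

Definition spd (R : realType) (k : nat) (A : 'M[R]_k) : Prop :=
  A \is symmetricmx /\
  forall x : 'cV[R]_k, x != 0 -> 0 < (x^T *m A *m x) ord0 ord0.

(* Neither u nor v may vanish, so that a k x l matrix has exactly
   minn k l singular values (with multiplicity): 0 is one of them iff the rank
   is not full. Nonzero vectors suffice: for s != 0 the two equations force u
   and v to have the same norm, and for s = 0 they scale independently. *)
Definition singular_value (R : realType) (k l : nat) (G : 'M[R]_(k, l))
    (s : R) : Prop :=
  0 <= s /\
  exists (u : 'cV[R]_k) (v : 'cV[R]_l),
    [/\ u != 0, v != 0, G *m v = s *: u & G^T *m u = s *: v].

Definition is_smallest (R : realType) (P : R -> Prop) (a : R) : Prop :=
  P a /\ forall b, P b -> a <= b.

Definition is_largest (R : realType) (P : R -> Prop) (a : R) : Prop :=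
  P a /\ forall b, P b -> b <= a.

Section Blocks.
Variables (R : realType) (N n : nat) (p : 'I_N.+1 -> nat).

(* The families Q_1, ..., Q_N and M_0, ..., M_(N-1) are both indexed by 'I_N:
   Q k stands for Q_(k+1) and M k for M_k. In both definitions below,
   unlift ord0 i is Some k exactly when i = k + 1, and None when i = 0. *)
Definition Dmx (B : 'M[R]_n) (Q : 'I_N -> 'M[R]_n)
    : 'M[R]_(\sum_(i < N.+1) n) :=
  \mxdiag_(i < N.+1) (if unlift ord0 i is Some k then Q k else B).

Definition Lmx (M : 'I_N -> 'M[R]_n)
    : 'M[R]_(\sum_(i < N.+1) n, \sum_(j < N.+1) n) :=
  \mxblock_(i < N.+1, j < N.+1)
    (if i == j then 1%:M
     else if unlift ord0 i is Some k then
       if (j == k :> nat) then - M k else 0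
     else 0).

Definition Rmx (Rb : forall i : 'I_N.+1, 'M[R]_(p i))
    : 'M[R]_(\sum_(i < N.+1) p i) :=
  \mxdiag_(i < N.+1) Rb i.

(* mxdiag only handles square diagonal blocks *)
Definition Hmx (H : forall i : 'I_N.+1, 'M[R]_(p i, n))
    : 'M[R]_(\sum_(i < N.+1) p i, \sum_(j < N.+1) n) :=
  \mxblock_(i < N.+1, j < N.+1) (if i == j then H i else 0).

End Blocks.

Definition A3mx (R : realType) (m q : nat) (D : 'M[R]_m) (Rm : 'M[R]_q)
    (L : 'M[R]_m) (H : 'M[R]_(q, m)) : 'M[R]_(m + q + m) :=
  block_mx (block_mx D 0 0 Rm) (col_mx L H) (row_mx L^T H^T) 0.

(* Main.v *)
(** Write the matrix as [(S, G^T; G, 0)] with [S = diag(D, R)] and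
    [G = (L^T  H^T)]. An eigenvector [(x, y)] satisfies [S x + G^T y = a x] and
    [G x = a y], hence [a <S x, x> + |G x|^2 = a^2 |x|^2]; the Rayleigh bounds
    on [S] and [G] then give every endpoint except the upper one of the
    negative interval. For that one, [T = S - a] satisfies [T x = - G^T y] and
    [0 <= T <= tau_max - a], so that
    [theta_min^2 |y|^2 <= |T x|^2 <= (tau_max - a) <T x, x>
    = - a (tau_max - a) |y|^2]. Since [L] is block unitriangular, [G] has full
    row rank, so [theta_min^2] is the smallest eigenvalue of [G G^T]. *)
Require Import Defs.
From mathcomp Require Import all_boot all_order all_algebra.
From mathcomp Require Import reals.
From mathcomp Require Import classical_sets.
From mathcomp Require Import ring lra.

Set Implicit Arguments.
Unset Strict Implicit.
Unset Printing Implicit Defensive.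

Import Order.TTheory GRing.Theory Num.Theory.
Local Open Scope ring_scope.

Section QuadraticForms.
Variable R : realType.

(** * Euclidean inner product and operator bounds *)

Definition dot (k : nat) (x y : 'cV[R]_k) : R := (x^T *m y) ord0 ord0.

Lemma dotE k (x y : 'cV[R]_k) : dot x y = \sum_i x i ord0 * y i ord0.
Proof. by rewrite /dot mxE; apply: eq_bigr => i _; rewrite mxE. Qed.

Lemma dotC k (x y : 'cV[R]_k) : dot x y = dot y x.
Proof. by rewrite !dotE; apply: eq_bigr => i _; rewrite mulrC. Qed.

Lemma dotDr k (x y z : 'cV[R]_k) : dot x (y + z) = dot x y + dot x z.
Proof. by rewrite /dot mulmxDr mxE. Qed.

Lemma dotNr k (x y : 'cV[R]_k) : dot x (- y) = - dot x y.
Proof. by rewrite /dot mulmxN mxE. Qed.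

Lemma dotZr k (x y : 'cV[R]_k) a : dot x (a *: y) = a * dot x y.
Proof. by rewrite /dot -scalemxAr mxE. Qed.

Lemma dotDl k (x y z : 'cV[R]_k) : dot (x + y) z = dot x z + dot y z.
Proof. by rewrite dotC dotDr !(dotC z). Qed.

Lemma dotNl k (x y : 'cV[R]_k) : dot (- x) y = - dot x y.
Proof. by rewrite dotC dotNr dotC. Qed.

Lemma dotZl k (x y : 'cV[R]_k) a : dot (a *: x) y = a * dot x y.
Proof. by rewrite dotC dotZr dotC. Qed.

Definition dot_linE := (dotDl, dotDr, dotNl, dotNr, dotZl, dotZr).

Lemma dot0 k (x : 'cV[R]_k) : dot x 0 = 0.
Proof. by rewrite /dot mulmx0 mxE. Qed.

Lemma dot_mulmxr k l (A : 'M[R]_(k, l)) x y :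
  dot x (A *m y) = dot (A^T *m x) y.
Proof. by rewrite /dot trmx_mul trmxK mulmxA. Qed.

Lemma dot_col_mx k l (x x' : 'cV[R]_k) (y y' : 'cV[R]_l) :
  dot (col_mx x y) (col_mx x' y') = dot x x' + dot y y'.
Proof. by rewrite /dot tr_col_mx mul_row_col mxE. Qed.

Lemma dot_ge0 k (x : 'cV[R]_k) : 0 <= dot x x.
Proof. by rewrite dotE sumr_ge0 // => i _; rewrite -expr2 sqr_ge0. Qed.

Lemma dot_eq0 k (x : 'cV[R]_k) : (dot x x == 0) = (x == 0).
Proof.
apply/eqP/eqP => [|->]; last by rewrite dot0.
rewrite dotE => /eqP; rewrite psumr_eq0; last first.
  by move=> i _; rewrite -expr2 sqr_ge0.
move=> /allP h; apply/colP => i; have := h i (mem_index_enum i).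
by rewrite mulf_eq0 orbb mxE => /eqP.
Qed.

Lemma dot_gt0 k (x : 'cV[R]_k) : x != 0 -> 0 < dot x x.
Proof. by move=> x0; rewrite lt_def dot_ge0 dot_eq0 x0. Qed.

Lemma cauchy_schwarz k (x y : 'cV[R]_k) : dot x y ^+ 2 <= dot x x * dot y y.
Proof.
have [->|/dot_gt0 y_gt0] := eqVneq y 0; first by rewrite !dot0 expr0n mulr0.
rewrite -subr_ge0 -(pmulr_rge0 _ y_gt0).
(* The squared norm of this vector is [dot y y * (dot x x * dot y y - dot x y ^+ 2)]. *)
have := dot_ge0 (dot y y *: x - dot x y *: y).
rewrite !dot_linE (dotC y x); lra.
Qed.

(** Cauchy-Schwarz on each row bounds the factor by the squared Frobenius norm [s]; taking [1 + s]
    makes it positive even for [A = 0]. *)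
Lemma mulmx_bounded k l (A : 'M[R]_(k, l)) :
  exists2 c : R, 0 < c & forall x, dot (A *m x) (A *m x) <= c * dot x x.
Proof.
pose s := \sum_i dot (row i A)^T (row i A)^T.
have s_ge0 : 0 <= s by apply: sumr_ge0 => i _; apply: dot_ge0.
exists (1 + s) => [|x]; first lra.
suff : dot (A *m x) (A *m x) <= s * dot x x by have := dot_ge0 x; nra.
rewrite [leLHS]dotE mulr_suml; apply: ler_sum => i _.
have -> : (A *m x) i ord0 = dot (row i A)^T x.
  by rewrite /dot trmxK -row_mul [RHS]mxE.
by rewrite -expr2 cauchy_schwarz.
Qed.

(** * Rayleigh quotients and extreme eigenvalues of symmetric matrices *)

Lemma symmetricmx_tr k (S : 'M[R]_k) : S \is symmetricmx -> S^T = S.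
Proof.
by move/is_hermitianmxP; rewrite expr0 scale1r map_mx_id // => {2}->.
Qed.

Lemma dot_mulmx_bounded k (S : 'M[R]_k) :
  exists2 c : R, 0 < c & forall x, dot x (S *m x) <= c * dot x x.
Proof.
have [c c_gt0 hc] := mulmx_bounded S; exists (1 + c) => [|x]; first lra.
have := dot_ge0 (x - S *m x); rewrite !dot_linE (dotC (S *m x) x).
by have := hc x; have := dot_ge0 x; nra.
Qed.

(* With [c - T] also positive semidefinite,
   [c T (c - T) = T (c - T) T + (c - T) T (c - T)] is positive semidefinite. *)
Lemma dot_mulmx_psd k (T : 'M[R]_k) (c : R) : T^T = T -> 0 < c ->
  (forall x, 0 <= dot x (T *m x)) -> (forall x, dot x (T *m x) <= c * dot x x) ->
  forall x, dot (T *m x) (T *m x) <= c * dot x (T *m x).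
Proof.
move=> symT c_gt0 T_ge0 T_le x; set y := T *m x.
have xTy : dot x (T *m y) = dot y y by rewrite dot_mulmxr symT.
have := T_le y; have := T_ge0 (c *: x - y).
rewrite mulmxBr -scalemxAr -/y !dot_linE xTy => h1 h2.
rewrite -subr_ge0 -(pmulr_rge0 _ c_gt0); nra.
Qed.

(** [eigenvalue] speaks of row eigenvectors; symmetry lets them be transposed into columns. *)
Lemma eigenvalue_symP k (S : 'M[R]_k) (a : R) : S^T = S ->
  reflect (exists2 x : 'cV_k, S *m x = a *: x & x != 0) (eigenvalue S a).
Proof.
move=> symS; apply: (iffP eigenvalueP) => -[v e v0]; exists v^T.
- by rewrite -[in LHS]symS -trmx_mul e linearZ.
- by rewrite trmx_eq0.
- by rewrite -[in LHS]symS -trmx_mul e linearZ.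
- by rewrite trmx_eq0.
Qed.

(* The supremum [l] of the Rayleigh quotient is an eigenvalue: otherwise the
   positive semidefinite [l - S] would be invertible, hence bounded below by
   some [e > 0], and [l - e] would still bound the Rayleigh quotient. *)
Lemma rayleigh_max k (S : 'M[R]_k) : S^T = S -> (0 < k)%N ->
  exists2 l, eigenvalue S l & forall x, dot x (S *m x) <= l * dot x x.
Proof.
move=> symS k_gt0.
pose E : set R := fun r => exists2 x, x != 0 & r = dot x (S *m x) / dot x x.
have [c c_gt0 hc] := dot_mulmx_bounded S.
have E0 : nonempty E.
  exists (dot (const_mx 1) (S *m (const_mx 1)) /
          dot (const_mx 1 : 'cV[R]_k) (const_mx 1)).
  exists (const_mx 1) => //; apply/cV0Pn; exists (Ordinal k_gt0).
  by rewrite mxE oner_eq0.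
have Eub : has_ubound E.
  by exists c => _ [x /dot_gt0 x0 ->]; rewrite ler_pdivrMr.
have le_sup x : dot x (S *m x) <= sup E * dot x x.
  have [->|x0] := eqVneq x 0; first by rewrite mulmx0 !dot0 mulr0.
  by rewrite -ler_pdivrMr ?dot_gt0 //; apply: ub_le_sup => //; exists x.
exists (sup E) => //; apply: contraT => nE.
pose T := (sup E)%:M - S.
have Tx x : T *m x = sup E *: x - S *m x by rewrite mulmxBl mul_scalar_mx.
have symT : T^T = T by rewrite linearB /= tr_scalar_mx symS.
have T_ge0 x : 0 <= dot x (T *m x) by rewrite Tx !dot_linE subr_ge0.
have unitT : T \in unitmx.
  (* [nE] says that the eigenspace of [S] at [sup E], which is the kernel of [- T], is trivial. *)
  rewrite -[T]opprB -scaleN1r unitmxZ ?unitrN1 // -row_free_unit -kermx_eq0.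
  exact: negbNE nE.
have [d d_gt0 hd] := dot_mulmx_bounded T.
have [f f_gt0 hf] := mulmx_bounded (invmx T).
(* Chain: [x] is [invmx T] applied to [T *m x], so [|x|^2 <= f |T x|^2 <= f d <x, T x>]. The gap
   below the supremum is thus [(f * d)^-1]. *)
have lower x : dot x x <= f * d * dot x (T *m x).
  have := hf (T *m x); rewrite mulKmx // => /le_trans; apply.
  by rewrite -mulrA ler_pM2l //; apply: dot_mulmx_psd.
have fd_gt0 : 0 < f * d by apply: mulr_gt0.
suff : sup E <= sup E - (f * d)^-1.
  by rewrite lerDl oppr_ge0 leNgt invr_gt0 fd_gt0.
apply: ge_sup => // _ [x x0 ->]; rewrite ler_pdivrMr ?dot_gt0 //.
rewrite mulrBl lerBrDr -lerBrDl ler_pdivrMl //.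
by have := lower x; rewrite Tx !dot_linE.
Qed.

Lemma le_largest_eigenvalue k (S : 'M[R]_k) l : S^T = S ->
  is_largest (eigenvalue S) l -> forall x, dot x (S *m x) <= l * dot x x.
Proof.
move=> symS [_ l_max] x; have [k0|k_gt0] := posnP k.
  by subst k; rewrite [x]flatmx0 mulmx0 !dot0 mulr0.
have [l' /l_max l'_le /(_ x)] := rayleigh_max symS k_gt0.
by move=> /le_trans; apply; rewrite ler_wpM2r ?dot_ge0.
Qed.

Lemma rayleigh_min k (S : 'M[R]_k) : S^T = S -> (0 < k)%N ->
  exists2 l, eigenvalue S l & forall x, l * dot x x <= dot x (S *m x).
Proof.
move=> symS k_gt0.
have symNS : (- S)^T = - S by rewrite linearN /= symS.
have [l] := rayleigh_max symNS k_gt0.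
move=> /(eigenvalue_symP _ symNS) [x Sx x0] hl; exists (- l) => [|y].
  apply/eigenvalue_symP => //; exists x => //.
  by rewrite scaleNr -Sx mulNmx opprK.
by have := hl y; rewrite mulNmx dotNr; lra.
Qed.

Lemma ge_smallest_eigenvalue k (S : 'M[R]_k) l : S^T = S ->
  is_smallest (eigenvalue S) l -> forall x, l * dot x x <= dot x (S *m x).
Proof.
move=> symS [_ l_min] x; have [k0|k_gt0] := posnP k.
  by subst k; rewrite [x]flatmx0 mulmx0 !dot0 mulr0.
have [l' /l_min l'_ge /(_ x)] := rayleigh_min symS k_gt0.
by apply: le_trans; rewrite ler_wpM2r ?dot_ge0.
Qed.

(** * Singular values through Gram matrices *)

Lemma tr_gram k l (G : 'M[R]_(k, l)) : (G^T *m G)^T = G^T *m G.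
Proof. by rewrite trmx_mul trmxK. Qed.

(** The left singular vector is [G *m v] divided by [Num.sqrt a]; it is nonzero because [G^T] sends
    it to a nonzero multiple of [v]. *)
Lemma singular_value_gram k l (G : 'M[R]_(k, l)) a (v : 'cV[R]_l) :
  0 < a -> v != 0 -> G^T *m G *m v = a *: v -> singular_value G (Num.sqrt a).
Proof.
move=> a_gt0 v0 Gv; have s_gt0 : 0 < Num.sqrt a by rewrite sqrtr_gt0.
split; first exact: ltW.
have GT : G^T *m ((Num.sqrt a)^-1 *: (G *m v)) = Num.sqrt a *: v.
  rewrite -scalemxAr mulmxA Gv scalerA -{2}(sqr_sqrtr (ltW a_gt0)).
  by rewrite expr2 mulKf ?gt_eqF.
exists ((Num.sqrt a)^-1 *: (G *m v)), v; split => //.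
- apply: contraNneq v0 => u0; move/eqP: GT.
  by rewrite u0 mulmx0 eq_sym scaler_eq0 gt_eqF.
- by rewrite scalerA divff ?gt_eqF // scale1r.
Qed.

Lemma singular_value_tr k l (G : 'M[R]_(k, l)) s :
  singular_value G^T s -> singular_value G s.
Proof.
by move=> [s0 [u [v [u0 v0 e1]]]]; rewrite trmxK => e2; split => //; exists v, u.
Qed.

Lemma le_largest_singular_value k l (G : 'M[R]_(k, l)) t :
  is_largest (singular_value G) t ->
  forall x, dot (G *m x) (G *m x) <= t ^+ 2 * dot x x.
Proof.
move=> [[t_ge0 [_ [v [_ v0 _ _]]]] t_max] x.
have l_gt0 : (0 < l)%N.
  by rewrite lt0n; apply: contra_neq v0 => l0; subst l; rewrite [v]flatmx0.
have [a ea ha] := rayleigh_max (tr_gram G) l_gt0.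
have [w Gw w0] := eigenvalue_symP _ (tr_gram G) ea.
have := ha x; rewrite -mulmxA dot_mulmxr trmxK => /le_trans; apply.
rewrite ler_wpM2r ?dot_ge0 //.
(* Only a positive top eigenvalue of [G^T *m G] is turned into a singular value; otherwise the bound
   follows from [0 <= t ^+ 2]. *)
have [a_le0|a_gt0] := leP a 0; first by rewrite (le_trans a_le0) ?sqr_ge0.
rewrite -(sqr_sqrtr (ltW a_gt0)) lerXn2r ?nnegrE ?sqrtr_ge0 //.
exact/t_max/(singular_value_gram a_gt0 w0 Gw).
Qed.

(** Injectivity of [G^T] makes [G *m G^T] positive definite, so the square root of its least
    eigenvalue is a nonzero singular value. On a nontrivial kernel of [G^T] the bound would fail,
    since [t] is nonzero. *)
Lemma ge_smallest_singular_value k l (G : 'M[R]_(k, l)) t :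
  (forall y : 'cV[R]_k, G^T *m y = 0 -> y = 0) ->
  is_smallest (fun s => s != 0 /\ singular_value G s) t ->
  forall y, t ^+ 2 * dot y y <= dot (G^T *m y) (G^T *m y).
Proof.
move=> G_inj [[_ [t_ge0 [u [_ [u0 _ _ _]]]]] t_min] y.
have k_gt0 : (0 < k)%N.
  by rewrite lt0n; apply: contra_neq u0 => k0; subst k; rewrite [u]flatmx0.
have [a ea ha] := rayleigh_min (tr_gram G^T) k_gt0.
have [w Gw w0] := eigenvalue_symP _ (tr_gram G^T) ea.
have := ha y; rewrite -mulmxA dot_mulmxr trmxK; apply: le_trans.
rewrite ler_wpM2r ?dot_ge0 //.
have a_gt0 : 0 < a.
  (* Pairing the eigenvector equation with [w] gives [a |w|^2 = |G^T w|^2]. *)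
  rewrite -(pmulr_lgt0 _ (dot_gt0 w0)) -dotZr -Gw -mulmxA dot_mulmxr trmxK.
  by apply: dot_gt0; apply: contra_neq w0; apply: G_inj.
rewrite -(sqr_sqrtr (ltW a_gt0)) lerXn2r ?nnegrE ?sqrtr_ge0 //.
apply: t_min; split; first by rewrite gt_eqF ?sqrtr_gt0.
exact/singular_value_tr/(singular_value_gram a_gt0 w0 Gw).
Qed.

(** * Spectrum of a saddle point matrix *)

(** The four constants enter only through quadratic form bounds, so the block structure of [S] and
    [G] can be forgotten here. *)
Lemma saddle_point_eigenvalue k l (S : 'M[R]_k) (G : 'M[R]_(l, k))
    (tau_min tau_max theta_min theta_max a : R) :
  S^T = S -> 0 < tau_min ->
  (forall x, tau_min * dot x x <= dot x (S *m x)) ->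
  (forall x, dot x (S *m x) <= tau_max * dot x x) ->
  (forall y : 'cV[R]_l, G^T *m y = 0 -> y = 0) ->
  (forall x, dot (G *m x) (G *m x) <= theta_max ^+ 2 * dot x x) ->
  (forall y, theta_min ^+ 2 * dot y y <= dot (G^T *m y) (G^T *m y)) ->
  eigenvalue (block_mx S G^T G 0) a ->
  (a < 0 ->
     a \in `[ 2^-1 * (tau_min - Num.sqrt (tau_min ^+ 2 + 4 * theta_max ^+ 2)),
              2^-1 * (tau_max - Num.sqrt (tau_max ^+ 2 + 4 * theta_min ^+ 2)) ])
  /\
  (0 < a ->
     a \in `[ tau_min,
              2^-1 * (tau_max + Num.sqrt (tau_max ^+ 2 + 4 * theta_max ^+ 2)) ]).
Proof.
move=> symS tau_gt0 S_ge S_le G_inj G_le G_ge.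
have symA : (block_mx S G^T G 0)^T = block_mx S G^T G 0.
  by rewrite tr_block_mx symS trmxK linear0.
case/(eigenvalue_symP _ symA) => z; rewrite -[z]vsubmxK.
set x := usubmx z; set y := dsubmx z.
rewrite mul_block_col mul0mx addr0 scale_col_mx col_mx_eq0.
move=> /eq_col_mx [e1 e2] xy0.
have xGy : dot x (G^T *m y) = a * dot y y by rewrite dot_mulmxr trmxK e2 dotZl.
have Gx : dot (G *m x) (G *m x) = a ^+ 2 * dot y y.
  by rewrite e2 !dot_linE mulrA.
have x_eq : dot x (S *m x) + a * dot y y = a * dot x x.
  by rewrite -xGy -dotDr e1 dotZr.
have x_neq0 : x != 0.
  apply: contraNneq xy0 => x0; rewrite x0 eqxx /=; apply/eqP/G_inj.
  by move: e1; rewrite x0 mulmx0 scaler0 add0r.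
have xx_gt0 := dot_gt0 x_neq0; have yy_ge0 := dot_ge0 y.
(* Multiplying [x_eq] by [a] yields [a <x, S x> + |G x|^2 = a^2 |x|^2]. As [a] may reverse
   inequalities, [t] will be [tau_min] for negative [a] and [tau_max] for positive [a]. *)
have quad_upper t : a * dot x (S *m x) <= a * (t * dot x x) ->
    a ^+ 2 - a * t <= theta_max ^+ 2.
  move=> h; rewrite -(ler_pM2r xx_gt0); have := G_le x; rewrite Gx; nra.
(* Completing the square: [(2 a - t)^2 = t^2 + 4 (a^2 - a t)]. *)
have sqrt_upper t : a ^+ 2 - a * t <= theta_max ^+ 2 ->
    `|2 * a - t| <= Num.sqrt (t ^+ 2 + 4 * theta_max ^+ 2).
  move=> h; rewrite -sqrtr_sqr ler_wsqrtr //; nra.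
split=> [a_lt0|a_gt0]; rewrite in_itv /=; apply/andP; split.
- have : a * dot x (S *m x) <= a * (tau_min * dot x x) by rewrite ler_nM2l.
  by move=> /quad_upper/sqrt_upper; rewrite ler_norml => /andP[]; lra.
(* With [y = 0], [x_eq] would make the Rayleigh quotient of [S] at [x] equal to [a < 0]. *)
- have y_neq0 : y != 0.
    apply/eqP => y0; move: x_eq (S_ge x); rewrite y0 dot0; nra.
  pose T := S - a%:M; have Tx z' : T *m z' = S *m z' - a *: z'.
    by rewrite mulmxBl mul_scalar_mx.
  have symT : T^T = T by rewrite linearB /= tr_scalar_mx symS.
  have tau_le : tau_min <= tau_max.
    by rewrite -(ler_pM2r xx_gt0) (le_trans (S_ge x)).
  have TxE : T *m x = - (G^T *m y).
    by rewrite Tx -e1 opprD addrA subrr sub0r.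
  have /(_ x) : forall z', dot (T *m z') (T *m z') <=
      (tau_max - a) * dot z' (T *m z').
    apply: dot_mulmx_psd => // [|z'|z']; first lra.
    - by rewrite Tx !dot_linE; have := S_ge z'; have := dot_ge0 z'; nra.
    - by rewrite Tx !dot_linE; have := S_le z'; lra.
  rewrite TxE !dot_linE opprK xGy => h.
  have h2 : theta_min ^+ 2 <= a ^+ 2 - a * tau_max.
    rewrite -(ler_pM2r (dot_gt0 y_neq0)); have := G_ge y; nra.
  suff : Num.sqrt (tau_max ^+ 2 + 4 * theta_min ^+ 2) <= `|2 * a - tau_max|.
    (* As [a < 0 < tau_max], the absolute value is [tau_max - 2 * a], which selects the negative
       root. *)
    rewrite ler0_norm; lra.
  rewrite -sqrtr_sqr ler_wsqrtr //; nra.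
(* In [x_eq] the term [a * dot y y] is nonnegative, so [a |x|^2 >= <x, S x>]. *)
- rewrite -(ler_pM2r xx_gt0); have := S_ge x; nra.
- have : a * dot x (S *m x) <= a * (tau_max * dot x x) by rewrite ler_pM2l.
  by move=> /quad_upper/sqrt_upper; rewrite ler_norml => /andP[]; lra.
Qed.

(** * Block diagonal and block bidiagonal matrices *)

Lemma spd_dot k (A : 'M[R]_k) :
  spd A <-> A^T = A /\ forall x, x != 0 -> 0 < dot x (A *m x).
Proof.
by split=> -[symA A_gt0]; split=> [|x /A_gt0]; rewrite /dot ?mulmxA //;
  [apply: symmetricmx_tr | apply/is_hermitianmxP; rewrite expr0 scale1r map_mx_id].
Qed.

(** The quadratic form is the sum of those of the blocks, and a nonzero vector has a nonzero block,
    which contributes a positive term. *)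
Lemma spd_mxdiag N (p : 'I_N -> nat) (A : forall i, 'M[R]_(p i)) :
  (forall i, spd (A i)) -> spd (\mxdiag_i A i).
Proof.
move=> A_spd; apply/spd_dot; split.
  by rewrite tr_mxdiag; apply/eq_mxdiagP => i; case/spd_dot: (A_spd i).
move=> x x0; rewrite -[x]submxcolK mul_mxdiag_mxcol.
rewrite /dot tr_mxcol mul_mxrow_mxcol summxE.
have term_gt0 i : submxcol x i != 0 ->
    0 < ((submxcol x i)^T *m (A i *m submxcol x i)) ord0 ord0.
  by case/spd_dot: (A_spd i) => _; apply.
have [i xi0] : exists i, submxcol x i != 0.
  apply/existsP; apply: contraNT x0 => /existsPn h; apply/eqP/mxcolP => i.
  by apply/eqP; rewrite submxcol0; have := h i; rewrite negbK.
rewrite (bigD1 i) //= ltr_pwDl ?term_gt0 // sumr_ge0 // => j _.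
have [->|/term_gt0/ltW //] := eqVneq (submxcol x j) 0.
by rewrite !mulmx0 mxE.
Qed.

(** Forward substitution: block row [i] expresses block [i] of [y] through block [i - 1], and block
    row 0 has only its diagonal term. *)
Lemma Lmx_inj N n (M : 'I_N -> 'M[R]_n)
    (y : 'cV[R]_(\sum_(i < N.+1) n)) : Lmx M *m y = 0 -> y = 0.
Proof.
move=> Ly; have row_eq (i : 'I_N.+1) : submxcol (Lmx M *m y) i = 0.
  by rewrite Ly submxcol0.
have {}row_eq i : \sum_j (if i == j then 1%:M
     else if unlift ord0 i is Some k then
       if (j == k :> nat) then - M k else 0
     else 0) *m submxcol y j = 0.
  rewrite -[RHS](row_eq i) /Lmx mxblockEv mxcol_mul mxcolK.
  by rewrite -[in RHS](submxcolK y) mul_mxrow_mxcol.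
suff y0 m (i : 'I_N.+1) : i = m :> nat -> submxcol y i = 0.
  by apply/mxcolP => i; rewrite submxcol0 (y0 i).
elim/ltn_ind: m i => m IH i im; have := row_eq i.
rewrite (bigD1 i) //= eqxx mul1mx big1 ?addr0 // => j ji.
rewrite eq_sym (negbTE ji); case: unliftP => [k ik|_]; last by rewrite mul0mx.
case: eqP => [jk|_]; last by rewrite mul0mx.
(* Here [i = lift ord0 k] has value [k + 1] and [j] has value [k], so the induction hypothesis
   applies to [j]. *)
by rewrite (IH j) ?mulmx0 // -im ik jk lift0.
Qed.

End QuadraticForms.

Theorem theorem4 (R : realType) (N n : nat) (hN : (1 <= N)%N) (hn : (1 <= n)%N)
  (p : 'I_N.+1 -> nat) (hp : (1 <= \sum_(i < N.+1) p i)%N)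
  (B : 'M[R]_n) (Q : 'I_N -> 'M[R]_n)
  (Rb : forall i : 'I_N.+1, 'M[R]_(p i))
  (M : 'I_N -> 'M[R]_n) (Hb : forall i : 'I_N.+1, 'M[R]_(p i, n))
  (hB : spd B) (hQ : forall k, spd (Q k)) (hR : forall i, spd (Rb i))
  (psi_min psi_max rho_min rho_max theta_min theta_max : R)
  (hpsi_min : is_smallest (eigenvalue (Dmx B Q)) psi_min)
  (hpsi_max : is_largest (eigenvalue (Dmx B Q)) psi_max)
  (hrho_min : is_smallest (eigenvalue (Rmx Rb)) rho_min)
  (hrho_max : is_largest (eigenvalue (Rmx Rb)) rho_max)
  (htheta_min : is_smallest
     (fun s => s != 0 /\ singular_value (row_mx (Lmx M)^T (Hmx Hb)^T) s)
     theta_min)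
  (htheta_max : is_largest
     (singular_value (row_mx (Lmx M)^T (Hmx Hb)^T)) theta_max) :
  let tau_min := Num.min psi_min rho_min in
  let tau_max := Num.max psi_max rho_max in
  forall a : R, eigenvalue (A3mx (Dmx B Q) (Rmx Rb) (Lmx M) (Hmx Hb)) a ->
    (a < 0 ->
       a \in `[ 2^-1 * (tau_min - Num.sqrt (tau_min ^+ 2 + 4 * theta_max ^+ 2)),
                2^-1 * (tau_max - Num.sqrt (tau_max ^+ 2 + 4 * theta_min ^+ 2)) ])
    /\
    (0 < a ->
       a \in `[ tau_min,
                2^-1 * (tau_max + Num.sqrt (tau_max ^+ 2 + 4 * theta_max ^+ 2)) ]).
Proof.
move=> tau_min tau_max a.
have hD : spd (Dmx B Q).
  by apply: spd_mxdiag => i; case: (unlift ord0 i).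
have hRm : spd (Rmx Rb) by apply: spd_mxdiag.
(* Testing positivity on an eigenvector; this will give [0 < tau_min]. *)
have spd_min k (S : 'M[R]_k) l : spd S -> is_smallest (eigenvalue S) l -> 0 < l.
  move=> /spd_dot [symS S_gt0] [/(eigenvalue_symP _ symS)[x Sx x0] _].
  by have := S_gt0 _ x0; rewrite Sx dotZr pmulr_lgt0 ?dot_gt0.
have symD := proj1 (proj1 (spd_dot _) hD).
have symR := proj1 (proj1 (spd_dot _) hRm).
set L := Lmx M in htheta_min htheta_max *.
set H := Hmx Hb in htheta_min htheta_max *.
rewrite /A3mx; set S := block_mx (Dmx B Q) 0 0 (Rmx Rb).
(* With [G] equal to [row_mx L^T H^T], the matrix takes the saddle point form, and injectivity of
   [G^T] is inherited from [L] alone. *)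
have -> : col_mx L H = (row_mx L^T H^T)^T by rewrite tr_row_mx !trmxK.
have dotS x y : dot (col_mx x y) (S *m col_mx x y) =
    dot x (Dmx B Q *m x) + dot y (Rmx Rb *m y).
  by rewrite mul_block_col !mul0mx addr0 add0r dot_col_mx.
have G_inj (y : 'cV[R]_(\sum_(j < N.+1) n)) :
    (row_mx L^T H^T)^T *m y = 0 -> y = 0.
  rewrite tr_row_mx !trmxK mul_col_mx => /eqP.
  by rewrite col_mx_eq0 => /andP[/eqP Ly _]; apply: Lmx_inj Ly.
apply: saddle_point_eigenvalue => //.
- by rewrite /S tr_block_mx symD symR !linear0.
- by rewrite lt_min (spd_min _ _ _ hD) ?(spd_min _ _ _ hRm).
(* The form of [S] splits over the two components; [tau_min] lies below the least eigenvalue of each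
   block, and dually for [tau_max] in the next goal. *)
- move=> z; rewrite -[z]vsubmxK dotS dot_col_mx mulrDr lerD //.
  + apply: le_trans (ge_smallest_eigenvalue symD hpsi_min _).
    by rewrite ler_wpM2r ?dot_ge0 // ge_min lexx.
  + apply: le_trans (ge_smallest_eigenvalue symR hrho_min _).
    by rewrite ler_wpM2r ?dot_ge0 // ge_min lexx orbT.
- move=> z; rewrite -[z]vsubmxK dotS dot_col_mx mulrDr lerD //.
  + apply: (le_trans (le_largest_eigenvalue symD hpsi_max _)).
    by rewrite ler_wpM2r ?dot_ge0 // le_max lexx.
  + apply: (le_trans (le_largest_eigenvalue symR hrho_max _)).
    by rewrite ler_wpM2r ?dot_ge0 // le_max lexx orbT.
- exact: le_largest_singular_value.
- exact: ge_smallest_singular_value.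
Qed.
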